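(* For every constant $c$ there is a polynomial-time algorithm that, given any finite graph $G$ of diameter at most $c$, outputs an optimal burning schedule of $G$, i.e. a burning schedule that burns all vertices of $G$ in $bn(G)$ rounds.
   Context: Graphs are finite, simple, undirected and unweighted; $d(u,v)$ denotes the shortest-path distance, and the diameter is the maximum distance between two vertices (so a graph of finite diameter is connected). Burning process: it takes place in synchronous rounds $1,2,\dots$. In each round $i$, every vertex having a neighbour that was burned in an earlier round becomes burned, and additionally one chosen vertex $a_i$ (the activator of round $i$) becomes burned; burned vertices stay burned. A burning schedule $\langle a_1,\dots,a_m\rangle$ burns $G$ in $m$ rounds if all vertices are burned by the end of round $m$, equivalently every vertex $v$ satisfies $d(v,a_i)\le m-i$ for some $i\in\{1,\dots,m\}$. The burning number $bn(G)$ is the minimum $m$ for which a burning schedule burning $G$ in $m$ rounds exists. *)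

(* Defs.v *)
From mathcomp Require Import all_boot.

Set Implicit Arguments.
Unset Strict Implicit.
Unset Printing Implicit Defensive.

(* Written with Mathematical Components.  A simple graph on a finite vertex   *)
(* type T is a symmetric irreflexive relation e : rel T.                      *)

Section Graph.

Variables (T : finType) (e : rel T).

Definition walk_of_length (k : nat) (u v : T) : bool :=
  [exists p : k.-tuple T, path e u p && (last u p == v)].

(* A shortest walk has fewer than #|T| edges, so the search range 0..#|T|-1   *)
(* loses nothing; dist u v = #|T| exactly when v is unreachable from u.       *)
Definition dist (u v : T) : nat :=
  find (fun k => walk_of_length k u v) (iota 0 #|T|).

(* Only meaningful on connected graphs, see the previous remark.              *)
Definition diameter : nat := \max_(u : T) \max_(v : T) dist u v.

Definition diameter_at_most (c : nat) : Prop :=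
  (forall u v, connect e u v) /\ diameter <= c.

(* One round with activator a, where B is the set of vertices burned in the   *)
(* earlier rounds.                                                            *)
Definition burn_round (B : {set T}) (a : T) : {set T} :=
  a |: (B :|: [set v | [exists u in B, e u v]]).

Definition burned (s : seq T) : {set T} := foldl burn_round set0 s.

(* The schedule s = [:: a_1; ...; a_m] burns the graph in m = size s rounds.  *)
Definition burns (s : seq T) : bool := burned s == [set: T].

Definition burnable_in (m : nat) : bool := [exists s : m.-tuple T, burns s].

Lemma activators_burned (s : seq T) : {subset s <= burned s}.
Proof.
elim/last_ind: s => // s a IHs x; rewrite mem_rcons in_cons /burned foldl_rcons.
case/orP=> [/eqP-> | /IHs xB]; first exact: setU11.
by rewrite /burn_round 2!in_setU xB orbT.
Qed.

Lemma burnable_exists : exists m, burnable_in m.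
Proof.
exists #|T|; apply/existsP; exists (enum_tuple T).
by apply/eqP/setP=> x; rewrite in_setT; apply: activators_burned; rewrite mem_enum.
Qed.

Definition burning_number : nat := ex_minn burnable_exists.

Definition optimal_schedule (s : seq T) : Prop :=
  burns s /\ size s = burning_number.

End Graph.

(* Algorithms are programs of a random access machine with instructions       *)
(* addressing registers directly and memory cells indirectly.  Each           *)
(* instruction costs one step; since addition and truncated subtraction are   *)
(* the only arithmetic operations, t steps lengthen the stored numbers by at  *)
(* most t bits, so polynomial time here is polynomial time on Turing machines. *)
Inductive instr : Type :=
  | Const of nat & nat        (* r k   : R[r] := k *)
  | Add of nat & nat & nat    (* r a b : R[r] := R[a] + R[b] *)
  | Sub of nat & nat & nat    (* r a b : R[r] := R[a] - R[b], truncated at 0 *)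
  | Read of nat & nat         (* r a   : R[r] := M[R[a]] *)
  | Write of nat & nat        (* a r   : M[R[a]] := R[r] *)
  | Jzero of nat & nat.       (* r l   : if R[r] = 0, go to instruction l *)

Definition program := seq instr.

Record config := Config { pc : nat; reg : nat -> nat; mem : nat -> nat }.

Definition exec (i : instr) (s : config) : config :=
  let: Config l R M := s in
  match i with
  | Const r k => Config l.+1 [eta R with r |-> k] M
  | Add r a b => Config l.+1 [eta R with r |-> R a + R b] M
  | Sub r a b => Config l.+1 [eta R with r |-> R a - R b] M
  | Read r a => Config l.+1 [eta R with r |-> M (R a)] M
  | Write a r => Config l.+1 R [eta M with R a |-> R r]
  | Jzero r l' => Config (if R r == 0 then l' else l.+1) R M
  end.

Definition halted (P : program) (s : config) : bool := size P <= pc s.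

Definition step (P : program) (s : config) : config :=
  if onth P (pc s) is Some i then exec i s else s.

Definition initial (w : seq nat) : config := Config 0 (fun=> 0) (nth 0 w).

(* The output is stored as its length in cell 0, followed by its items.       *)
Definition output (s : config) : seq nat := mkseq (fun i => mem s i.+1) (mem s 0).

Definition computes_within (P : program) (w : seq nat) (t : nat) (o : seq nat)
  : Prop :=
  exists2 t', t' <= t &
    halted P (iter t' (step P) (initial w)) /\
    output (iter t' (step P) (initial w)) = o.

(* The number of vertices followed by the adjacency matrix in row-major order. *)
Definition encode_graph (n : nat) (e : rel 'I_n) : seq nat :=
  n :: [seq nat_of_bool (e i j) | i <- enum 'I_n, j <- enum 'I_n].

(* Main.v *)
(* A graph of diameter at most c is burned within c + 1 rounds by repeating    *)
(* any vertex as activator.  For a fixed number m of rounds, the sentence      *)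
(* "there are activators a_1, ..., a_m that burn every vertex" is first-order  *)
(* over the graph, and a fixed first-order formula of quantifier depth q is    *)
(* decided by q nested loops over the vertices, in O(n^q) steps.  The program  *)
(* tries m = 0, ..., c + 1 in turn; when the sentence for m is first found     *)
(* true, the loop counters of its leading quantifiers are an optimal schedule. *)

Require Import Defs.
From mathcomp Require Import all_boot all_algebra.
From mathcomp Require Import zify.

Set Implicit Arguments.
Unset Strict Implicit.
Unset Printing Implicit Defensive.

(** Diameter at most [c] gives a burning number of at most [c + 1] ([burning_number_diameter]), so
    only constantly many schedule lengths [m] have to be tried. For each [m], burnability is a fixed
    first-order sentence with [m] leading existential quantifiers, whose kernel [holds_all_burned]
    identifies with [burns]. [compile] turns a formula into short-circuiting code with one loop over
    the vertices per quantifier. [compile_correct] and [compile_Ex_witness] prove this code right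
    within [cost] steps, and for a fixed formula [cost] is polynomial in [n] ([poly_bounded_cost]).
    [attempts_correct] combines these: lengths are tried in increasing order, so the first success
    has the optimal length, and the loop counters it leaves behind are the schedule. *)

Arguments onth : simpl never.

(** * Hoare triples with a step bound *)

Definition reaches (P : program) (s : config) (k : nat) (post : config -> Prop) :=
  exists2 t, t <= k & post (iter t (step P) s).

Fixpoint code_at (P : program) (base : nat) (code : seq instr) : Prop :=
  if code is i :: code' then onth P base = Some i /\ code_at P base.+1 code'
  else True.

(** Postcondition of code with two exits. The memory stays the given [M], because evaluating a
    formula never writes. *)
Inductive outcome (M : nat -> nat) (lt lf : nat) (Qt Qf : (nat -> nat) -> Prop) :
    config -> Prop :=
  | Success R of Qt R : outcome M lt lf Qt Qf (Config lt R M)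
  | Failure R of Qf R : outcome M lt lf Qt Qf (Config lf R M).

Lemma code_at_cat P base c1 c2 :
  code_at P base (c1 ++ c2) <-> code_at P base c1 /\ code_at P (base + size c1) c2.
Proof.
elim: c1 base => [|i c1 IH] base /=; first by rewrite addn0; intuition.
by rewrite IH addSnnS; intuition.
Qed.

Lemma code_at_self (Q P : program) : code_at (Q ++ P) (size Q) P.
Proof.
elim: P Q => //= i P IH Q; split; last by have := IH (rcons Q i); rewrite cat_rcons size_rcons.
by rewrite onth_cat ltnn subnn.
Qed.

Lemma reaches0 P s k (post : config -> Prop) : post s -> reaches P s k post.
Proof. by exists 0. Qed.

Lemma reaches_leq P s k k' post :
  k <= k' -> reaches P s k post -> reaches P s k' post.
Proof. by move=> le_k [t le_t H]; exists t => //; apply: leq_trans le_k. Qed.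

Lemma reaches_imply P s k (post post' : config -> Prop) :
  (forall s', post s' -> post' s') -> reaches P s k post -> reaches P s k post'.
Proof. by move=> imp [t le_t H]; exists t => //; apply: imp. Qed.

Lemma reaches_trans P s k k' (post post' : config -> Prop) :
  reaches P s k post -> (forall s', post s' -> reaches P s' k' post') ->
  reaches P s (k + k') post'.
Proof.
move=> [t le_t H] /(_ _ H) [t' le_t' H'].
by exists (t' + t); [lia | rewrite iterD].
Qed.

Lemma reaches_step P i l R M k post :
  onth P l = Some i -> reaches P (exec i (Config l R M)) k post ->
  reaches P (Config l R M) k.+1 post.
Proof.
move=> Pl [t le_t H]; exists t.+1 => //.
by rewrite iterSr {2}/step /= Pl.
Qed.

(** * First-order formulas over a graph and their compilation *)

(* Variables are de Bruijn levels: at depth d the quantifier binds variable d. *)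
Inductive formula : Type :=
  | Eq of nat & nat
  | Adj of nat & nat
  | Not of formula
  | And of formula & formula
  | Ex of formula.

Definition Or f g := Not (And (Not f) (Not g)).
Definition All f := Not (Ex (Not f)).

Fixpoint scoped (d : nat) (f : formula) : bool :=
  match f with
  | Eq i j | Adj i j => (i < d) && (j < d)
  | Not f => scoped d f
  | And f g => scoped d f && scoped d g
  | Ex f => scoped d.+1 f
  end.

(* Registers 0, 1, 2 hold 0, 1 and the number n of vertices, registers 3 and 4 *)
(* are scratch.  For variable i with value x, [xreg i] holds x and [yreg i]    *)
(* holds n x + 1, the address of row x of the adjacency matrix; the machine    *)
(* has no multiplication, so the latter is maintained incrementally.           *)
Definition xreg (i : nat) := 5 + i.*2.
Definition yreg (i : nat) := 6 + i.*2.

(** Register 0 always holds 0, so [Jzero 0] is an unconditional jump, here back to the test at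
    [base.+2]. A body that fails must fall through to the increments after it. *)
Definition loop (d base lf : nat) (body : seq instr) : seq instr :=
  [:: Const (xreg d) 0; Const (yreg d) 1; Defs.Sub 3 2 (xreg d); Jzero 3 lf] ++ body ++
  [:: Add (xreg d) (xreg d) 1; Add (yreg d) (yreg d) 2; Jzero 0 base.+2].

Fixpoint code_size (f : formula) : nat :=
  match f with
  | Eq _ _ => 5
  | Adj _ _ => 4
  | Not f => code_size f
  | And f g => code_size f + code_size g
  | Ex f => code_size f + 7
  end.

(* Control leaves the code at label [lt] if the formula holds, at [lf] if not. *)
Fixpoint compile (f : formula) (d base lt lf : nat) : seq instr :=
  match f with
  | Eq i j => [:: Defs.Sub 3 (xreg i) (xreg j); Defs.Sub 4 (xreg j) (xreg i); Add 3 3 4;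
                  Jzero 3 lt; Jzero 0 lf]
  | Adj i j => [:: Add 3 (yreg i) (xreg j); Read 3 3; Jzero 3 lf; Jzero 0 lt]
  | Not f => compile f d base lf lt
  | And f g => let next := base + code_size f in
               compile f d base next lf ++ compile g d next lt lf
  | Ex f => loop d base lf (compile f d.+1 (base + 4) lt (base + 4 + code_size f))
  end.

(** Each pass through a loop adds 5 steps to its body: 2 for the test, 3 for the increments and the
    jump. The other 4 are the initialisation and the final test. *)
Fixpoint cost (f : formula) (n : nat) : nat :=
  match f with
  | Eq _ _ => 5
  | Adj _ _ => 4
  | Not f => cost f n
  | And f g => cost f n + cost g n
  | Ex f => n * (cost f n + 5) + 4
  end.

Lemma size_compile f d base lt lf : size (compile f d base lt lf) = code_size f.
Proof.
elim: f d base lt lf => //= [f IHf g IHg | f IH] d base lt lf.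
  by rewrite size_cat IHf IHg.
by rewrite size_cat IH /=; lia.
Qed.

(** * Correctness and running time of compiled formulas *)

Section Correctness.

Variables (P : program) (M : nat -> nat) (n : nat).

(** Adjacency is read from memory; the successor skips cell 0, which holds the number of
    vertices. *)
Fixpoint holds (f : formula) (s : seq nat) : bool :=
  match f with
  | Eq i j => nth 0 s i == nth 0 s j
  | Adj i j => M (nth 0 s i * n + nth 0 s j).+1 != 0
  | Not f => ~~ holds f s
  | And f g => holds f s && holds g s
  | Ex f => has (fun x => holds f (rcons s x)) (iota 0 n)
  end.

Record env (R : nat -> nat) (s : seq nat) : Prop := Env {
  env0 : R 0 = 0;
  env1 : R 1 = 1;
  env2 : R 2 = n;
  envx : forall i, i < size s -> R (xreg i) = nth 0 s i;
  envy : forall i, i < size s -> R (yreg i) = (nth 0 s i * n).+1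
}.

Lemma env_eq R R' s :
  (forall r, r < xreg (size s) -> r != 3 -> r != 4 -> R' r = R r) ->
  env R s -> env R' s.
Proof.
rewrite /xreg => eqR [R0 R1 R2 Rx Ry].
by split=> [|||i lt_i|i lt_i]; rewrite eqR ?Rx ?Ry //; rewrite /xreg /yreg; lia.
Qed.

Lemma env_prefix R s s' : env R (s ++ s') -> env R s.
Proof.
case=> R0 R1 R2 Rx Ry; split=> // i lt_i.
  by rewrite Rx ?nth_cat ?lt_i // size_cat; lia.
by rewrite Ry ?nth_cat ?lt_i // size_cat; lia.
Qed.

Lemma env_rcons R s x :
  env R s -> R (xreg (size s)) = x -> R (yreg (size s)) = (x * n).+1 ->
  env R (rcons s x).
Proof.
case=> R0 R1 R2 Rx Ry Rxs Rys; split=> // i; rewrite size_rcons ltnS leq_eqVlt nth_rcons.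
  by case/orP=> [/eqP-> | lt_i]; rewrite ?ltnn ?eqxx // lt_i Rx.
by case/orP=> [/eqP-> | lt_i]; rewrite ?ltnn ?eqxx // lt_i Ry.
Qed.

(** [Qt] is left arbitrary because a successful exit either forgets the loop variable
    ([compile_correct]) or keeps it as a witness ([compile_Ex_witness]). *)
Lemma loop_correct s base lt lf body k (B : nat -> Prop) Qt R :
  code_at P base (loop (size s) base lf body) ->
  (forall x R, x < n -> env R (rcons s x) ->
     reaches P (Config (base + 4) R M) k
       (outcome M lt (base + 4 + size body) Qt
          (fun R' => env R' (rcons s x) /\ B x))) ->
  env R s ->
  reaches P (Config base R M) (n * (k + 5) + 4)
    (outcome M lt lf Qt (fun R' => env R' s /\ forall x, x < n -> B x)).
Proof.
case=> P0 [P1 [P2 [P3 /code_at_cat[_ [P4 [P5 [P6 _]]]]]]] Hbody envR.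
(* Invariant at the loop test: [j] passes remain, and [x] may already equal [n]. *)
have head j x R' : x + j = n -> env R' (rcons s x) -> (forall y, y < x -> B y) ->
    reaches P (Config base.+2 R' M) (j * (k + 5) + 2)
      (outcome M lt lf Qt (fun R' => env R' s /\ forall x, x < n -> B x)).
  elim: j x R' => [|j IH] x R' def_n envR' Bx.
    rewrite mul0n; apply: (reaches_step P2); apply: (reaches_step P3); apply: reaches0 => /=.
    have Rx := envx envR'; rewrite size_rcons in Rx.
    rewrite (env2 envR') Rx ?ltnS // nth_rcons ltnn eqxx.
    have -> : n - x == 0 by lia.
    apply: Failure; split=> [|y lt_y]; last by apply: Bx; lia.
    apply: (@env_eq R'); last by rewrite -cats1 in envR'; apply: env_prefix envR'.
    by move=> r _ /negPf /= ->.
  rewrite mulSn; apply: (@reaches_leq _ _ (2 + (k + (3 + (j * (k + 5) + 2))))); first by lia.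
  apply: (reaches_step P2); apply: (reaches_step P3) => /=.
  have Rx := envx envR'; rewrite size_rcons in Rx.
  rewrite (env2 envR') Rx ?ltnS // nth_rcons ltnn eqxx.
  have -> : (n - x == 0) = false by lia.
  rewrite -addn4; apply: (reaches_trans (Hbody x _ _ _)); first by lia.
    by apply: env_eq envR' => r _ /negPf /= ->.
  move=> _ [R2 HR2 | R2 [envR2 HBx]]; first by apply: reaches0; apply: Success.
  rewrite -addn4 in P4 P5 P6.
  apply: (reaches_step P4); apply: (reaches_step P5); apply: (reaches_step P6).
  have [R2_0 R2_1 R2_2 _ _] := envR2.
  have := envx envR2 (i := size s); have := envy envR2 (i := size s).
  rewrite size_rcons ltnSn nth_rcons ltnn eqxx => /(_ isT) R2y /(_ isT) R2x.
  rewrite /= !R2_0; apply: (IH x.+1); first by lia.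
    apply: env_rcons => [||] /=.
    - rewrite -cats1 in envR2; apply: env_eq (env_prefix envR2) => r /=.
      by rewrite /yreg /xreg => lt_r _ _; rewrite !ifN //; lia.
    - rewrite eqxx ifN ?R2x ?R2_1; last by rewrite /xreg /yreg; lia.
      by lia.
    - rewrite eqxx (_ : (yreg _ == xreg _) = false) ?R2y /= ?R2_2; last first.
        by rewrite /xreg /yreg; lia.
      by lia.
  by move=> y; rewrite ltnS leq_eqVlt => /orP[/eqP-> | /Bx].
apply: (@reaches_leq _ _ (2 + (n * (k + 5) + 2))); first by lia.
apply: (reaches_step P0); apply: (reaches_step P1); apply: (head n 0) => //.
apply: env_rcons => [||] /=; rewrite ?eqxx //.
  apply: env_eq envR => r /=.
  by rewrite /yreg /xreg => lt_r _ _; rewrite !ifN //; lia.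
by rewrite ifN //; rewrite /xreg /yreg; lia.
Qed.

Lemma loop_body d base lf body :
  code_at P base (loop d base lf body) -> code_at P (base + 4) body.
Proof.
by rewrite /loop => /code_at_cat[_ /code_at_cat[]].
Qed.

Lemma compile_correct f s base lt lf R :
  scoped (size s) f -> code_at P base (compile f (size s) base lt lf) -> env R s ->
  reaches P (Config base R M) (cost f n)
    (outcome M lt lf (fun R' => env R' s /\ holds f s)
                     (fun R' => env R' s /\ ~~ holds f s)).
Proof.
elim: f s base lt lf R => [i j|i j|f IH|f IHf g IHg|f IH] s base lt lf R /=.
- case/andP=> lt_i lt_j [P0 [P1 [P2 [P3 [P4 _]]]]] envR.
  apply: (reaches_step P0); apply: (reaches_step P1); apply: (reaches_step P2).
  apply: (reaches_step P3).
  rewrite /= (envx envR lt_i) (envx envR lt_j).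
  set R' := (X in Config _ X _).
  have envR' : env R' s by apply: env_eq envR => r _; rewrite {}/R' /= => /negPf-> /negPf->.
  (* With truncated subtraction, the sum of the two differences is 0 exactly when the values
     agree. *)
  case: eqP => Hij; last first.
    apply: (reaches_step P4); apply: reaches0; rewrite /= (env0 envR').
    by apply: Failure; split=> //; apply/eqP; lia.
  by apply: reaches0; apply: Success; split=> //; apply/eqP; lia.
- case/andP=> lt_i lt_j [P0 [P1 [P2 [P3 _]]]] envR.
  apply: (reaches_step P0); apply: (reaches_step P1); apply: (reaches_step P2).
  rewrite /= (envx envR lt_j) (envy envR lt_i) addSn.
  set R' := (X in Config _ X _).
  have envR' : env R' s by apply: env_eq envR => r _; rewrite {}/R' /= => /negPf->.
  case: eqP => Hij; first by apply: reaches0; apply: Failure; split=> //; rewrite Hij.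
  apply: (reaches_step P3); apply: reaches0; rewrite /= (env0 envR').
  by apply: Success; split=> //; apply/eqP.
- move=> scf Pf envR; apply: (reaches_imply _ (IH _ _ _ _ _ scf Pf envR)).
  by move=> _ [R' ? | R' ?]; [apply: Failure; rewrite negbK | apply: Success].
- case/andP=> scf scg /code_at_cat[Pf Pg] envR; rewrite size_compile in Pg.
  apply: (reaches_trans (IHf _ _ _ _ _ scf Pf envR)) => _ [R' [envR' Hf] | R' [envR' Hf]].
    by rewrite Hf; apply: IHg.
  by apply: reaches0; apply: Failure; rewrite (negPf Hf).
- move=> scf Pf envR.
  have Pbody := loop_body Pf.
  apply: (reaches_imply _ (loop_correct (lt := lt) (k := cost f n)
    (B := fun x => ~~ holds f (rcons s x))
    (Qt := fun R' => env R' s /\ holds (Ex f) s) Pf _ envR)).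
    move=> _ [R' // | R' [envR' nHf]]; first exact: Success.
    apply: Failure; split=> //; apply/hasPn => x; rewrite mem_iota; exact: nHf.
  move=> x R' lt_x envR'; rewrite size_compile.
  apply: (reaches_imply _ (IH (rcons s x) _ _ _ _ _ _ envR')); last 2 first.
  + by rewrite size_rcons.
  + by rewrite size_rcons; apply: Pbody.
  move=> _ [R2 [envR2 Hf] | R2 H]; last exact: Failure.
  apply: Success; split; first by rewrite -cats1 in envR2; apply: env_prefix envR2.
  by apply/hasP; exists x; rewrite ?mem_iota.
Qed.

(* On success the registers of the outermost quantifiers keep a witness. *)
Lemma compile_Ex_witness m f s base lt lf R :
  scoped (size s + m) f ->
  code_at P base (compile (iter m Ex f) (size s) base lt lf) -> env R s ->
  reaches P (Config base R M) (cost (iter m Ex f) n)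
    (outcome M lt lf
      (fun R' => exists t, [/\ size t = m, all (ltn^~ n) t,
                               env R' (s ++ t) & holds f (s ++ t)])
      (fun R' => env R' s /\
         forall t, size t = m -> all (ltn^~ n) t -> ~~ holds f (s ++ t))).
Proof.
elim: m s base lt lf R => [|m IH] s base lt lf R.
  rewrite addn0 => scf Pf envR.
  apply: (reaches_imply _ (compile_correct scf Pf envR)) => _ [R' [envR' Hf] | R' [envR' Hf]].
    by apply: Success; exists [::]; rewrite cats0.
  by apply: Failure; split=> // t /size0nil -> _; rewrite cats0.
rewrite addnS => scf /= Pf envR; have Pbody := loop_body Pf.
apply: (reaches_imply _ (loop_correct (lt := lt) (k := cost (iter m Ex f) n)
    (B := fun x => forall t, size t = m -> all (ltn^~ n) t -> ~~ holds f (rcons s x ++ t))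
    (Qt := fun R' => exists t, [/\ size t = m.+1, all (ltn^~ n) t,
                               env R' (s ++ t) & holds f (s ++ t)]) Pf _ envR)).
  move=> _ [R' // | R' [envR' nHf]]; first exact: Success.
  apply: Failure; split=> // -[|x t] //= [size_t] /andP[lt_x all_t].
  by rewrite -cat_rcons nHf.
move=> x R' lt_x envR'; rewrite size_compile.
apply: (reaches_imply _ (IH (rcons s x) _ _ _ _ _ _ envR')); last 2 first.
+ by rewrite size_rcons addSn.
+ by rewrite size_rcons; apply: Pbody.
move=> _ [R2 [t [size_t all_t envR2 Hf]] | R2 H]; last exact: Failure.
by apply: Success; exists (x :: t); rewrite -cat_rcons /= size_t lt_x.
Qed.

(** The length [m] is separate from [k] so that induction on [k] keeps cell 0 fixed. Overwriting the
    graph is harmless: a schedule has been found by then. *)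
Fixpoint emit (m k : nat) : seq instr :=
  if k is k'.+1 then emit m k' ++ [:: Const 3 k; Write 3 (xreg k')]
  else [:: Const 3 0; Const 4 m; Write 3 4].

Lemma size_emit m k : size (emit m k) = k.*2 + 3.
Proof. by elim: k => //= k IH; rewrite size_cat IH /=; lia. Qed.

Lemma emit_correct m k s base R :
  code_at P base (emit m k) -> env R s -> k <= size s ->
  reaches P (Config base R M) (k.*2 + 3) (fun c =>
    [/\ pc c = base + (k.*2 + 3), env (reg c) s, Defs.mem c 0 = m
      & forall i, i < k -> Defs.mem c i.+1 = nth 0 s i]).
Proof.
move=> Pk envR; elim: k Pk => [|k IH] Pk lt_k.
  case: Pk => P0 [P1 [P2 _]].
  apply: (reaches_step P0); apply: (reaches_step P1); apply: (reaches_step P2).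
  apply: reaches0; split=> //=; first by lia.
  by apply: env_eq envR => r _ /negPf /= -> /negPf ->.
case/code_at_cat: Pk => Pk; rewrite size_emit => -[P0 [P1 _]].
rewrite doubleS -[X in X.+2]addn0 -!addnS addnAC.
apply: (reaches_trans (IH Pk (ltnW lt_k))) => -[l R1 M1] /= [-> envR1 M1_0 M1s].
apply: (reaches_step P0); apply: (reaches_step P1); apply: reaches0.
split=> /=; first by lia.
- by apply: env_eq envR1 => r _ /negPf /= ->.
- by [].
move=> i; rewrite ltnS leq_eqVlt eqSS (envx envR1 lt_k).
by case: eqP => [-> // | _] /= /M1s.
Qed.

End Correctness.

(** * Burning as a first-order property *)

(* Variable v is burned by the activators held by variables 0, ..., k-1. *)
Fixpoint burned_formula (k d v : nat) : formula :=
  if k is k'.+1 then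
    Or (Eq v k') (Or (burned_formula k' d v) (Ex (And (burned_formula k' d.+1 d) (Adj d v))))
  else Not (Eq v v).

Definition all_burned (m : nat) : formula := All (burned_formula m m.+1 m).

Lemma scoped_burned_formula k d v :
  k <= d -> v < d -> scoped d (burned_formula k d v).
Proof.
elim: k d v => [|k IH] d v le_k lt_v /=; first by rewrite lt_v.
by rewrite lt_v le_k ltnSn leqW // !IH //; lia.
Qed.

Lemma holds_Or M n f g s : holds M n (Or f g) s = holds M n f s || holds M n g s.
Proof. by rewrite /= negb_and !negbK. Qed.

Section Burning.

Variables (n : nat) (e : rel 'I_n) (M : nat -> nat).
Hypothesis M_adj : forall i j : 'I_n, M (i * n + j).+1 = e i j.

Lemma has_iotaE (p : pred nat) : has p (iota 0 n) = [exists x : 'I_n, p x].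
Proof.
apply/hasP/existsP => [[x] | [x px]]; last by exists (val x); rewrite // mem_iota ltn_ord.
by rewrite mem_iota => lt_x px; exists (Ordinal lt_x).
Qed.

(** Induction on the activators from the last one, as in [foldl]. The activator peeled off [a] and
    the newly quantified neighbour both pass into [b], which must therefore be general. *)
Lemma holds_burned_formula (a b : seq 'I_n) (v : nat) (x : 'I_n) :
  v < size (a ++ b) -> nth 0 (map val (a ++ b)) v = x ->
  holds M n (burned_formula (size a) (size (a ++ b)) v) (map val (a ++ b)) =
  (x \in burned e a).
Proof.
elim/last_ind: a b v x => [|a y IH] b v x lt_v def_x.
  by rewrite /= eqxx inE.
rewrite size_rcons cat_rcons in lt_v def_x *; rewrite /burned foldl_rcons -/(burned e a).
rewrite [burned_formula _ _ _]/= !holds_Or !inE; congr (_ || (_ || _)).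
- by rewrite /= def_x map_cat nth_cat size_map ltnn subnn.
- exact: IH.
rewrite /= has_iotaE; apply: eq_existsb => u.
rewrite -map_rcons rcons_cat.
have -> : (size (a ++ y :: b)).+1 = size (a ++ rcons (y :: b) u).
  by rewrite -rcons_cat size_rcons.
have def_u : nth 0 (map val (a ++ rcons (y :: b) u)) (size (a ++ y :: b)) = u.
  by rewrite -rcons_cat map_rcons nth_rcons size_map ltnn eqxx.
have def_v : nth 0 (map val (a ++ rcons (y :: b) u)) v = x.
  by rewrite -rcons_cat map_rcons nth_rcons size_map lt_v.
rewrite (IH _ _ _ _ def_u) ?def_u ?def_v; last by rewrite -rcons_cat size_rcons.
by rewrite M_adj; case: (e u x).
Qed.

Lemma holds_all_burned (a : seq 'I_n) :
  holds M n (all_burned (size a)) (map val a) = burns e a.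
Proof.
have burnedE (x : 'I_n) :
    holds M n (burned_formula (size a) (size a).+1 (size a)) (rcons (map val a) x) =
    (x \in burned e a).
  rewrite -map_rcons -cats1 -addn1 -(size_cat a [:: x]).
  apply: holds_burned_formula; first by rewrite size_cat addn1.
  by rewrite cats1 map_rcons nth_rcons size_map ltnn eqxx.
rewrite /= has_iotaE negb_exists; apply/forallP/eqP => [all_a | full_a x].
  by apply/setP => x; rewrite in_setT -burnedE; have := all_a x; rewrite negbK.
by rewrite negbK burnedE full_a in_setT.
Qed.

End Burning.

Lemma holds_burnable n (e : rel 'I_n) (M : nat -> nat) (t : seq nat) :
  (forall i j : 'I_n, M (i * n + j).+1 = e i j) -> all (ltn^~ n) t ->
  holds M n (all_burned (size t)) t ->
  exists2 a : seq 'I_n, t = map val a & burns e a.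
Proof.
move=> M_adj lt_t Ht.
have [a def_t] : exists a : seq 'I_n, t = map val a.
  elim: t lt_t {Ht} => [|x t IH] /=; first by exists [::].
  by case/andP=> lt_x /IH[a ->]; exists (Ordinal lt_x :: a).
by exists a => //; rewrite -(holds_all_burned M_adj) -def_t -[size a](size_map val) -def_t.
Qed.

(** * Burning number and diameter *)

Lemma burnable_inP (T : finType) (e : rel T) m :
  reflect (exists2 a : seq T, size a = m & burns e a) (burnable_in e m).
Proof.
apply: (iffP existsP) => [[a burns_a] | [a /eqP size_a burns_a]].
  by exists a; rewrite ?size_tuple.
by exists (Tuple size_a).
Qed.

(** The fire lit at [u] in round 1 advances one edge in every later round. *)
Lemma path_burned (T : finType) (e : rel T) (u : T) (p : seq T) k :
  path e u p -> size p < k -> last u p \in burned e (nseq k u).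
Proof.
elim: k p => // k IH p; case/lastP: p => [|p x].
  by move=> _ _; apply: activators_burned; rewrite mem_head.
rewrite rcons_path last_rcons size_rcons ltnS => /andP[path_p e_x] lt_p.
rewrite -addn1 nseqD cats1 /burned foldl_rcons -/(burned e _) !inE.
by apply/or3P/Or33/existsP; exists (last u p); rewrite IH.
Qed.

(** The search in [dist] succeeds, since a path without repeated vertices has fewer than [#|T|]
    edges. *)
Lemma dist_walk (T : finType) (e : rel T) (u v : T) :
  connect e u v -> walk_of_length e (dist e u v) u v.
Proof.
case/connectP=> p0 path_p0 ->; case/shortenP: path_p0 => p path_p uniq_p _.
have lt_p : size p < #|T| by have := max_card (mem (u :: p)); rewrite (card_uniqP uniq_p).
have : has (fun k => walk_of_length e k u (last u p)) (iota 0 #|T|).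
  apply/hasP; exists (size p); first by rewrite mem_iota.
  by apply/existsP; exists (in_tuple p); rewrite /= path_p eqxx.
move=> has_walk; have := nth_find 0 has_walk; rewrite nth_iota //.
by rewrite -[X in _ < X](size_iota 0) -has_find.
Qed.

Lemma burning_number_diameter n (e : rel 'I_n) c :
  diameter_at_most e c -> burning_number e <= c.+1.
Proof.
case: n e => [|n] e [conn_e diam_e]; rewrite /burning_number; case: ex_minnP => m _ min_m.
  (* The empty graph has no vertex to repeat, but the empty schedule burns it. *)
  apply: leq_trans (min_m 0 _) _ => //; apply/burnable_inP.
  by exists [::] => //; apply/eqP/setP => -[].
apply: min_m; apply/burnable_inP; exists (nseq c.+1 ord0); first exact: size_nseq.
apply/eqP/setP => v; rewrite in_setT.
have /existsP[p /andP[path_p /eqP <-]] := dist_walk (conn_e ord0 v).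
apply: path_burned => //; rewrite size_tuple ltnS; apply: leq_trans diam_e.
apply: leq_trans (leq_bigmax (F := fun u => \max_v dist e u v) ord0).
exact: (leq_bigmax (F := fun v => dist e ord0 v)).
Qed.

(** * The adjacency matrix in the input *)

Lemma nth_flatten_const (T : Type) (x0 : T) (ss : seq (seq T)) n i j :
  all (fun s => size s == n) ss -> j < n ->
  nth x0 (flatten ss) (i * n + j) = nth x0 (nth [::] ss i) j.
Proof.
elim: ss i => [|s ss IH] i /=; first by rewrite !nth_nil.
case/andP=> /eqP size_s all_ss lt_j; rewrite nth_cat size_s.
case: i => [|i]; first by rewrite mul0n add0n lt_j.
by rewrite mulSn -addnA ltnNge leq_addr addKn /= IH.
Qed.

Lemma nth_encode_graph n (e : rel 'I_n) (i j : 'I_n) :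
  nth 0 (encode_graph e) (i * n + j).+1 = e i j.
Proof.
rewrite /= (@nth_flatten_const _ _ _ n) //; last first.
  by apply/allP => _ /mapP[x _ ->]; rewrite size_map size_enum_ord.
rewrite (nth_map i) ?size_enum_ord // (nth_map i) ?size_enum_ord //.
by rewrite !nth_ord_enum.
Qed.

Lemma size_encode_graph n (e : rel 'I_n) : n <= size (encode_graph e).
Proof. by rewrite /= size_allpairs size_enum_ord; nia. Qed.

(** * The algorithm *)

Definition attempt (m : nat) : formula := iter m Ex (all_burned m).

Fixpoint attempts (halt base m r : nat) : seq instr :=
  if r is r'.+1 then
    let found := base + code_size (attempt m) in
    let next := found + (m.*2 + 4) in
    compile (attempt m) 0 base found next ++
    (emit m m ++ [:: Jzero 0 halt]) ++ attempts halt next m.+1 r'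
  else [::].

Fixpoint attempts_cost (m r n : nat) : nat :=
  if r is r'.+1 then cost (attempt m) n + (m.*2 + 4 + attempts_cost m.+1 r' n) else 0.

(** The size does not depend on the labels, so the halting label can be computed from the size of
    the very code that mentions it. *)
Lemma size_attempts halt base halt' base' m r :
  size (attempts halt base m r) = size (attempts halt' base' m r).
Proof.
elim: r base base' m => //= r IH base base' m.
rewrite !size_cat !size_compile; do 2!congr (_ + _); exact: IH.
Qed.

(** The lower bound on the burning number records that all lengths below [m] have failed; the upper
    bound ensures that some attempt succeeds. *)
Lemma attempts_correct P n (e : rel 'I_n) (M : nat -> nat) halt base m r R :
  (forall i j : 'I_n, M (i * n + j).+1 = e i j) ->
  code_at P base (attempts halt base m r) -> size P <= halt -> env n R [::] ->
  m <= burning_number e < m + r ->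
  reaches P (Config base R M) (attempts_cost m r n) (fun c =>
    halted P c /\ exists2 s, optimal_schedule e s & output c = map val s).
Proof.
move=> M_adj; elim: r m base R => [|r IH] m base R.
  by rewrite addn0 => _ _ _ /andP[/leq_ltn_trans lt_m /lt_m]; rewrite ltnn.
case/code_at_cat=> Pf; rewrite size_compile => /code_at_cat[/code_at_cat[Pe [Pj _]]].
rewrite size_cat size_emit -[size [:: _]]/1 -(addnA m.*2) => Pr le_halt envR /andP[le_m lt_m].
have sc : scoped (size (Nil nat) + m) (all_burned m).
  by rewrite /= scoped_burned_formula.
apply: (reaches_trans (compile_Ex_witness M sc Pf envR)).
move=> _ [R' [t [size_t lt_t envR' Ht]] | R' [envR' Hnone]]; last first.
  apply: (reaches_leq (leq_addl _ _)).
  apply: (IH _ _ _ Pr) => //; rewrite addSnnS lt_m andbT ltn_neqAle le_m andbT.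
  (* Were [m] the burning number, an optimal schedule would be a witness, contrary to the
     failure. *)
  apply/eqP => def_m; move: def_m; rewrite /burning_number.
  case: ex_minnP => b /burnable_inP[a size_a burns_a] _ def_m.
  have := Hnone (map val a); rewrite size_map size_a def_m => /(_ erefl).
  rewrite -size_a in def_m *.
  rewrite (holds_all_burned M_adj) burns_a => /(_ _)/negP[] //.
  by apply/allP => _ /mapP[x _ ->]; apply: ltn_ord.
rewrite !cat0s -{1}size_t in envR' Ht.
have [a def_t burns_a] := holds_burnable M_adj lt_t Ht.
apply: (@reaches_leq _ _ (m.*2 + 3 + 1)); first by rewrite -addnA leq_addr.
rewrite size_emit in Pj.
have le_mt : m <= size t by rewrite size_t.
apply: (reaches_trans (emit_correct M Pe envR' le_mt)).
move=> [l R1 M1] /= [-> envR1 M1_0 M1t].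
apply: (reaches_step Pj); apply: reaches0; rewrite /= (env0 envR1) eqxx; split=> //.
exists a.
  (* The witness bounds the burning number by [m], and the invariant gives the converse. *)
  split=> //; rewrite -(size_map val) -def_t size_t; apply/eqP; rewrite eqn_leq le_m.
  rewrite /burning_number; case: ex_minnP => b _ -> //.
  by apply/burnable_inP; exists a; rewrite // -(size_map val) -def_t.
rewrite -def_t /output /= M1_0; apply: (@eq_from_nth _ 0); rewrite size_mkseq //.
by move=> i lt_i; rewrite nth_mkseq // M1t.
Qed.

(** * Polynomial bounds *)

(* The argument of the polynomial may exceed that of the function, so that a   *)
(* bound in terms of the number of vertices is one in terms of the input size. *)
Definition poly_bounded (f : nat -> nat) : Prop :=
  exists p : {poly nat}, forall n k, n <= k -> f n <= (p.[k])%R.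

Lemma poly_bounded_const a : poly_bounded (fun=> a).
Proof. by exists (a%:P)%R => n k _; rewrite hornerC. Qed.

Lemma poly_bounded_add f g :
  poly_bounded f -> poly_bounded g -> poly_bounded (fun n => f n + g n).
Proof.
move=> [p Hp] [q Hq]; exists (p + q)%R => n k le_n.
by rewrite hornerD leq_add ?Hp ?Hq.
Qed.

Lemma poly_bounded_mul_id f : poly_bounded f -> poly_bounded (fun n => n * f n).
Proof.
move=> [p Hp]; exists (p * 'X)%R => n k le_n.
by rewrite hornerMX mulnC leq_mul ?Hp.
Qed.

Lemma poly_bounded_cost f : poly_bounded (cost f).
Proof.
elim: f => [i j|i j|f IH|f IHf g IHg|f IH] //=; try exact: poly_bounded_const.
  exact: poly_bounded_add.
apply: poly_bounded_add; last exact: poly_bounded_const.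
by apply/poly_bounded_mul_id/poly_bounded_add => //; apply: poly_bounded_const.
Qed.

Lemma poly_bounded_attempts m r : poly_bounded (attempts_cost m r).
Proof.
elim: r m => [|r IH] m /=; first exact: poly_bounded_const.
apply: poly_bounded_add; first exact: poly_bounded_cost.
by apply: poly_bounded_add (IH _); apply: poly_bounded_const.
Qed.

Theorem theorem2 (c : nat) :
  exists (P : program) (p : {poly nat}),
    forall (n : nat) (e : rel 'I_n),
      symmetric e -> irreflexive e -> diameter_at_most e c ->
      exists2 s : seq 'I_n,
        optimal_schedule e s &
        computes_within P (encode_graph e) (p.[size (encode_graph e)])%R
          [seq val a | a <- s].
Proof.
(* The 2 counts the instructions of [code], which load 1 and the number of vertices. The [c.+2]
   attempts cover the lengths 0 to [c + 1]. *)
pose halt := 2 + size (attempts 0 0 0 c.+2).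
pose code := [:: Const 1 1; Read 2 0].
have [p Hp] := poly_bounded_add (poly_bounded_const 2) (poly_bounded_attempts 0 c.+2).
exists (code ++ attempts halt 2 0 c.+2), p => n e _ _ diam_e.
set P := code ++ _; set w := encode_graph e.
have size_P : size P <= halt by rewrite /P size_cat (size_attempts _ _ 0 0).
have [t le_t [halted_t [s opt_s out_s]]] :
    reaches P (initial w) (2 + attempts_cost 0 c.+2 n) (fun c =>
      halted P c /\ exists2 s, optimal_schedule e s & output c = map val s).
  have P0 : onth P 0 = Some (Const 1 1) by [].
  have P1 : onth P 1 = Some (Read 2 0) by [].
  apply: (reaches_step P0); apply: (reaches_step P1).
  apply: (attempts_correct (nth_encode_graph e) (code_at_self code _)) => //.
  - by rewrite add0n ltnS burning_number_diameter.
exists s => //; exists t; last by [].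
by apply: leq_trans le_t _; apply: Hp; apply: size_encode_graph.
Qed.
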